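(* For every fixed $l\ge1$: $N_{2l+1}(n)=\Omega_l(n^3)$ and $A_{2l+1}(n)=O_l(n^2)$.
   Context: There are $n$ balls, each colored red or blue in an unknown way. A ball $b$ is a majority ball of a set $A$ if more than $|A|/2$ balls of $A$ have the color of $b$, and a non-minority ball of $A$ if at least $|A|/2$ balls of $A$ have the color of $b$. A query is a set of $q$ balls and the answer is (the index of) a majority ball of the query, chosen adversarially (for odd $q$ one always exists). The goal is to name a ball guaranteed to be a non-minority ball of the whole set, i.e. non-minority in every coloring consistent with the answers. $A_q(n)$ (resp. $N_q(n)$) is the minimum worst-case number of queries needed when queries may be chosen adaptively (resp. must all be fixed in advance). $f(l,n)=\Omega_l(g(n))$ means that for each $l$ there is $c_l>0$ with $f(l,n)\ge c_l g(n)$ for all $n$; $O_l$ is defined analogously with $\le C_l g(n)$.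
   Formalization: The bounds are proved for all n ≥ 2l+1 rather than for all n: for n = 1, 2 no query is needed, so N = 0 and the cubic lower bound fails, and for 3 ≤ n ≤ 2l no query of size 2l+1 exists and the minima are undefined. *)

(* Defs.v *)
From mathcomp Require Import all_boot.

Set Implicit Arguments.
Unset Strict Implicit.
Unset Printing Implicit Defensive.

(* The two colors are the two booleans. *)
Definition coloring (n : nat) := {ffun 'I_n -> bool}.

Definition same_color n (c : coloring n) (A : {set 'I_n}) (b : 'I_n) :=
  [set x in A | c x == c b].

Definition majority_ball n (c : coloring n) (A : {set 'I_n}) (b : 'I_n) :=
  (b \in A) && (#|A| < 2 * #|same_color c A b|).

Definition nonminority_ball n (c : coloring n) (A : {set 'I_n}) (b : 'I_n) :=
  (b \in A) && (#|A| <= 2 * #|same_color c A b|).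

Definition query (q n : nat) := {Q : {set 'I_n} | #|Q| == q}.

(* The queries asked so far, each paired with the ball given as its answer. *)
Definition transcript (q n : nat) := seq (query q n * 'I_n).

Definition consistent q n (h : transcript q n) (c : coloring n) :=
  all (fun Qa => majority_ball c (val Qa.1) Qa.2) h.

Definition guaranteed_nonminority q n (h : transcript q n) (b : 'I_n) :=
  forall c : coloring n, consistent h c -> nonminority_ball c [set: 'I_n] b.

(* Adaptive strategies are decision trees.  Every query is answered by a ball,
   so this models the problem for odd q only. *)
Inductive strategy (q n : nat) : Type :=
| Guess of 'I_n
| Ask of query q n & ('I_n -> strategy q n).

(* [run t h b]: the strategy t, receiving the answers recorded in h, asks
   exactly the queries recorded in h and then names b. *)
Inductive run q n : strategy q n -> transcript q n -> 'I_n -> Prop :=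
| run_Guess b : run (Guess q b) [::] b
| run_Ask Q f a h b : run (f a) h b -> run (Ask Q f) ((Q, a) :: h) b.

(* Only transcripts the adversary can produce, i.e. those consistent with at
   least one coloring, count towards the worst case. *)
Definition adaptively_solvable (q n k : nat) : Prop :=
  exists t : strategy q n, forall h b, run t h b ->
    (exists c, consistent h c) ->
    size h <= k /\ guaranteed_nonminority h b.

Definition nonadaptively_solvable (q n k : nat) : Prop :=
  exists (Qs : k.-tuple (query q n)) (guess : k.-tuple 'I_n -> 'I_n),
  forall answers : k.-tuple 'I_n,
    guaranteed_nonminority (zip Qs answers) (guess answers).

Definition is_minimum (P : nat -> Prop) (m : nat) : Prop :=
  P m /\ forall k, P k -> m <= k.

(* A_q(n) = m and N_q(n) = m.  These are relations because the minimum does not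
   exist for all q and n: e.g. no query can be asked when 2 < n < q. *)
Definition A_is (q n m : nat) : Prop := is_minimum (adaptively_solvable q n) m.
Definition N_is (q n m : nat) : Prop :=
  is_minimum (nonadaptively_solvable q n) m.

(* Main.v *)
Require Import Defs.
From mathcomp Require Import all_boot all_order all_algebra.
From mathcomp Require Import reals boolp zify.

Import Order.TTheory GRing.Theory Num.Theory.

Set Implicit Arguments.
Unset Strict Implicit.
Unset Printing Implicit Defensive.

(** Write [q = 2l + 1].

    Common majority balls.  If, for a set of colorings, each [q]-subset of a
    set [W] has a ball that is a majority ball in all of them, the same holds
    for each larger odd subset.  Hence asking all queries inside [W] determines
    a non-minority ball of [W], and both minima exist.

    Upper bound.  Keep a set [K] of [2l] balls, repeatedly add a new ball [z] of
    [W], ask [K + z] and discard the answer.  When [W] is exhausted, either [K]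
    is split evenly, or all discarded balls have the majority color of [K];
    either way a non-minority ball of [W \ K] is one of [W].  Iterating removes
    [2l] balls at the cost of at most [n] queries, until [W] has bounded size.

    Lower bound.  Let [R] and [Y] be disjoint pairs of balls and let [B] contain
    all other balls of the queries meeting both.  If [A], the set of
    the remaining balls, has about [n / 2] elements, then each query has a ball
    that is a majority ball in the three colorings with color classes [A],
    [B + R] and [B + Y], while each ball is in the minority in one of them.  So
    the queries meeting both [R] and [Y] cover about [n / 2] balls, and there
    are linearly many of them for each of the quadratically many choices of
    [R] and [Y]. *)

(* [lia] treats two cardinals whose [finType] instances are only convertible as
   different atoms; [set] identifies them. *)
Ltac card_lia :=
  intros;
  repeat match goal with
  | H : is_true _ |- _ => revert H
  | H : @eq nat _ _ |- _ => revert H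
  | H : @eq bool _ _ |- _ => revert H
  end;
  repeat match goal with
  | |- context [card ?A] => let k := fresh "k" in set k := (card A); clearbody k
  end;
  clear; intros; lia.

(** * Subsets of prescribed size and the union bound *)

Lemma exists_subset_card (T : finType) (A : {set T}) m : m <= #|A| ->
  exists2 B : {set T}, B \subset A & #|B| = m.
Proof.
rewrite -bin_gt0 -cards_draws card_gt0 => /set0Pn[B]; rewrite inE => /andP[sBA /eqP cB].
by exists B.
Qed.

Lemma exists_between_card (T : finType) (A V : {set T}) m : A \subset V -> #|A| <= m <= #|V| ->
  exists B : {set T}, [/\ A \subset B, B \subset V & #|B| = m].
Proof.
move=> sAV /andP[leA leV].
have cV : #|V| = #|A| + #|V :\: A| by rewrite -(cardsID A) (setIidPr sAV).
have [|C sC cC] := @exists_subset_card _ (V :\: A) (m - #|A|).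
  by move: leA leV cV; clear; card_lia.
exists (A :|: C); split; first exact: subsetUl.
  by rewrite subUset sAV (subset_trans sC (subsetDl _ _)).
rewrite cardsU cC; have -> : A :&: C = set0.
  apply/setP => x; rewrite !inE; apply/andP => -[xA /(subsetP sC)].
  by rewrite inE xA.
by rewrite cards0 subn0 subnKC.
Qed.

Lemma card_bigcup_leq (I T : finType) (P : pred I) (F : I -> {set T}) m :
  (forall i, P i -> #|F i| <= m) -> #|\bigcup_(i | P i) F i| <= #|[set i | P i]| * m.
Proof.
move=> leF; rewrite cardsE -sum_nat_const.
apply: (@leq_trans (\sum_(i | P i) #|F i|)); last exact: leq_sum.
elim/big_rec2: _ => [|i s A _ leA]; first by rewrite cards0.
by rewrite cardsU; move: leA; clear; card_lia.
Qed.

(** * Color counts in a set *)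

Section ColorCounts.
Variable n : nat.
Implicit Types (c : coloring n) (A B : {set 'I_n}) (x y : 'I_n) (v : bool).

Definition color_class c A v := [set x in A | c x == v].

Lemma same_colorE c A x : same_color c A x = color_class c A (c x).
Proof. by []. Qed.

Lemma card_color_class c A : #|color_class c A true| + #|color_class c A false| = #|A|.
Proof.
rewrite -(cardsID [set x | c x] A); congr (_ + _); apply: eq_card => x; rewrite !inE.
  by rewrite eqb_id.
by case: (c x); rewrite /= ?andbT ?andbF.
Qed.

Lemma color_classN c A v : #|color_class c A v| + #|color_class c A (~~ v)| = #|A|.
Proof. by case: v; [|rewrite addnC]; rewrite /= card_color_class. Qed.

Lemma color_classD1 c A x v : x \in A ->
  #|color_class c A v| = (c x == v) + #|color_class c (A :\ x) v|.
Proof.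
move=> xA; rewrite (cardsD1 x); congr (_ + _); first by rewrite inE xA.
by apply: eq_card => y; rewrite !inE andbA.
Qed.

Lemma color_classD c A B v : B \subset A ->
  #|color_class c A v| = #|color_class c B v| + #|color_class c (A :\: B) v|.
Proof.
move=> /subsetP sBA; rewrite -(cardsID B); congr (_ + _); apply: eq_card => x; rewrite !inE.
  case xB: (x \in B); last by rewrite andbF.
  by rewrite (sBA _ xB) /= andbT.
by rewrite andbA.
Qed.

Lemma color_class_le c A v : #|color_class c A v| <= #|A|.
Proof. by apply/subset_leq_card/subsetP => x; rewrite inE => /andP[]. Qed.

Definition majority_color c A := #|A| < 2 * #|color_class c A true|.

Lemma majority_colorP c A v : odd #|A| ->
  (#|A| < 2 * #|color_class c A v|) = (v == majority_color c A).
Proof.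
rewrite /majority_color; have := card_color_class c A.
by case: v; case: ltnP => //=; lia.
Qed.

Lemma majority_ballE c A x : odd #|A| ->
  majority_ball c A x = (x \in A) && (c x == majority_color c A).
Proof. by move=> oA; rewrite /majority_ball same_colorE majority_colorP. Qed.

End ColorCounts.

(** * Common majority balls of larger odd sets *)

Section CommonMajority.
Variable n : nat.
Implicit Types (X : {set {ffun 'I_n -> bool}}) (A : {set 'I_n}).

Definition common_majority X A := exists a, forall c : coloring n, c \in X -> majority_ball c A a.

(* Let [S] have size [q + 2] and call a coloring tight if it splits [S] as
   [l + 2 : l + 1].  Deleting [x] and [y] changes the majority color only in
   the tight colorings where both are in the majority, and the common majority
   ball of the remaining [q] balls is in the minority of [S] exactly there.  If this
   always happens, the sets [Z x] of tight colorings where [x] is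
   in the minority are pairwise disjoint, whereas each tight coloring lies in
   [l + 1 >= 2] of them. *)
Lemma common_majority_step X l (S : {set 'I_n}) : 0 < l -> #|S| = 2 * l + 3 ->
  (forall A, A \subset S -> #|A| = 2 * l + 1 -> common_majority X A) ->
  common_majority X S.
Proof.
move=> l_gt0 cS goodS.
have oS : odd #|S| by rewrite cS; clear; lia.
pose minor (c : coloring n) x := c x != majority_color c S.
pose tight (c : coloring n) := #|color_class c S (majority_color c S)| == l.+2.
have maj c : #|S| < 2 * #|color_class c S (majority_color c S)| by rewrite majority_colorP.
have drop2 x y (c : coloring n) : x \in S -> y \in S -> x != y ->
    majority_color c (S :\: [set x; y]) =
    majority_color c S (+) [&& tight c, ~~ minor c x & ~~ minor c y].
  move=> xS yS xy.
  have sxy : [set x; y] \subset S by apply/subsetP => z; rewrite !inE => /orP[] /eqP->.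
  have cD : #|S :\: [set x; y]| = 2 * l + 1.
    by have := cardsID [set x; y] S; rewrite (setIidPr sxy) cards2 xy cS /=; card_lia.
  have oD : odd #|S :\: [set x; y]| by rewrite cD; clear; lia.
  apply/esym/eqP; rewrite -majority_colorP // cD.
  have := maj c; rewrite /tight /minor !negbK; set v := majority_color c S.
  have := color_classD c v sxy; have := color_classN c (S :\: [set x; y]) v.
  have -> : #|color_class c [set x; y] v| = (c x == v) + (c y == v).
    rewrite (@color_classD1 _ _ _ x) ?inE ?eqxx //; congr (_ + _).
    rewrite (@color_classD1 _ _ _ y); last by rewrite !inE eqxx orbT eq_sym xy.
    have -> : [set x; y] :\ x :\ y = set0.
      by apply/setP => z; rewrite !inE; case: (z == x); case: (z == y).
    rewrite -[RHS]addn0; congr (_ + _); apply/eqP; rewrite -leqn0 -(cards0 'I_n).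
    exact: color_class_le.
  rewrite cD cS.
  have card_goal (a a' k : nat) (b b' : bool) : a + a' = 2 * l + 1 -> k = b + b' + a ->
      2 * l + 3 < 2 * k -> 2 * l + 1 < 2 * (if [&& k == l.+2, b & b'] then a' else a).
    by clear; case: (k =P l.+2) => t; case: b; case: b' => /=; lia.
  move=> aE kE kgt; have := card_goal _ _ _ _ _ aE kE kgt.
  by case: [&& _, _ & _]; rewrite ?addbT ?addbF.
have [//|nS] := pselect (common_majority X S).
have ex2 x y : x \in S -> y \in S -> x != y ->
    exists2 z, z \in S :\: [set x; y] &
      forall c, c \in X -> minor c z = [&& tight c, ~~ minor c x & ~~ minor c y].
  move=> xS yS xy.
  have sxy : [set x; y] \subset S by apply/subsetP => z; rewrite !inE => /orP[] /eqP->.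
  have cD : #|S :\: [set x; y]| = 2 * l + 1.
    by have := cardsID [set x; y] S; rewrite (setIidPr sxy) cards2 xy cS /=; card_lia.
  have oD : odd #|S :\: [set x; y]| by rewrite cD; clear; lia.
  have [z zP] := goodS _ (subsetDl _ _) cD.
  have [X0|[c0 c0X]] := set_0Vmem X.
    by case: nS; exists x => c; rewrite X0 inE.
  exists z; first by have := zP _ c0X; rewrite majority_ballE // => /andP[].
  move=> c cX; have := zP _ cX; rewrite majority_ballE // => /andP[_ /eqP].
  by rewrite drop2 // /minor => ->; case: (majority_color c S); case: [&& _, _ & _].
pose tau := [set c in X | tight c].
pose Z x := [set c in tau | minor c x].
have exZ x y : x \in S -> y \in S -> x != y ->
    exists z, [/\ z \in S, z != x, Z z = tau :\: (Z x :|: Z y) & Z z != set0].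
  move=> xS yS xy; have [z zS zP] := ex2 _ _ xS yS xy.
  move: zS; rewrite !inE => /andP[/norP[zx zy] zS].
  have Zz : Z z = tau :\: (Z x :|: Z y).
    apply/setP => c; rewrite !inE; case cX: (c \in X) => //=.
    by rewrite zP //; case: (minor c x); case: (minor c y); case: (tight c).
  (* If [Z z] were empty, [z] would be a common majority ball of [S]. *)
  exists z; split => //; apply/negP => /eqP Z0; apply: nS; exists z => c cX.
  rewrite majority_ballE // zS /=; apply: contraT => mz.
  have: minor c z by [].
  have: c \in Z z = false by rewrite Z0 inE.
  by rewrite !inE cX /= zP //; case: (tight c) => //= ->.
have diffZ x y : x \in S -> y \in S -> x != y ->
    exists2 w, w \in S & Z w = Z y :\: Z x /\ Z w != set0.
  move=> xS yS xy; have [z [zS zx Ez _]] := exZ _ _ xS yS xy.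
  (* Applying [exZ] again, to [x] and [z], complements once more inside [tau] and leaves
     [Z y :\: Z x]. *)
  have [|w [wS _ Ew w0]] := exZ x z xS zS; first by rewrite eq_sym.
  exists w => //; split => //; rewrite Ew Ez; apply/setP => c; rewrite !inE.
  by case: (c \in X); case: (tight c); case: (minor c x); case: (minor c y).
have disjZ x y : x \in S -> y \in S -> x != y -> Z y :\: Z x = Z y.
  move=> xS yS xy; have [w wS [Ew w0]] := diffZ _ _ xS yS xy.
  have [E|wy] := eqVneq y w; first by rewrite -Ew E.
  (* For [w != y], the set [Z w :\: Z y] would be nonempty, although [Z w] is contained in [Z y]. *)
  have [u _ [Eu /negP[]]] := diffZ _ _ yS wS wy.
  by rewrite Eu Ew setD_eq0 subsetDl.
have [x xS] : exists x, x \in S by apply/set0Pn; rewrite -card_gt0 cS; card_lia.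
have [y] : exists y, y \in S :\ x.
  by apply/set0Pn; rewrite -card_gt0; have := cardsD1 x S; rewrite xS cS; card_lia.
rewrite !inE => /andP[yx yS]; rewrite eq_sym in yx.
have [z [zS _ _ /set0Pn[c]]] := exZ _ _ xS yS yx.
rewrite 2!inE => /andP[/andP[cX tc] _].
have: 1 < #|color_class c S (~~ majority_color c S)|.
  have := color_classN c S (majority_color c S); rewrite (eqP tc) cS; card_lia.
case/card_gt1P => u [w]; rewrite !inE; case=> /andP[uS cu] /andP[wS cw] uw.
have min_u : minor c u by rewrite /minor (eqP cu); case: majority_color.
have min_w : minor c w by rewrite /minor (eqP cw); case: majority_color.
have := disjZ _ _ uS wS uw => /setP/(_ c); rewrite !inE cX tc min_u min_w.
by [].
Qed.

Lemma common_majority_odd X l (W : {set 'I_n}) : 0 < l ->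
  (forall A, A \subset W -> #|A| = 2 * l + 1 -> common_majority X A) ->
  forall j A, A \subset W -> #|A| = 2 * (l + j) + 1 -> common_majority X A.
Proof.
move=> l_gt0 base; elim=> [|j IHj] A sAW cA; first by apply: base; rewrite // cA addn0.
apply: (@common_majority_step X (l + j)); [lia|rewrite cA; lia|].
by move=> B sBA cB; apply: IHj => //; apply: subset_trans sAW.
Qed.

(** If [#|W|] is even, one ball is left out: a strict majority of the odd rest is at least half of
    [W]. *)
Lemma common_nonminority X l (W : {set 'I_n}) : 0 < l -> 2 * l + 1 <= #|W| ->
  (forall A, A \subset W -> #|A| = 2 * l + 1 -> common_majority X A) ->
  exists b, forall c : coloring n, c \in X -> nonminority_ball c W b.
Proof.
move=> l_gt0 geW base; have odds := common_majority_odd l_gt0 base.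
case oW: (odd #|W|).
  have [|b bP] := odds (#|W|./2 - l) W (subxx _); first card_lia.
  by exists b => c /bP/andP[bW lt]; rewrite /nonminority_ball bW ltnW.
have [x xW] : exists x, x \in W by apply/set0Pn; rewrite -card_gt0; card_lia.
have cW : #|W| = #|W :\ x|.+1 by rewrite (cardsD1 x W) xW.
have [|b bP] := odds (#|W|./2 - l - 1) (W :\ x) (subsetDl _ _); first card_lia.
exists b => c /bP/andP[]; rewrite inE => /andP[_ bW].
rewrite /nonminority_ball bW !same_colorE (@color_classD1 _ _ W x) //=; card_lia.
Qed.

End CommonMajority.

(** * Strategies for colorings from a known set *)

Section Strategies.
Variables q n : nat.
Implicit Types (X Y : {set {ffun 'I_n -> bool}}) (Q : query q n).

(** [X] holds the colorings still possible, so that earlier answers enter only by shrinking [X]. *)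
Definition solvable_within X k := exists t : strategy q n, forall h b, run t h b ->
  (exists2 c : coloring n, c \in X & consistent h c) ->
  size h <= k /\
  forall c : coloring n, c \in X -> consistent h c -> nonminority_ball c [set: 'I_n] b.

Lemma solvable_within_le X k m : k <= m -> solvable_within X k -> solvable_within X m.
Proof.
move=> le_km [t tP]; exists t => h b rt hX.
by have [sz ok] := tP h b rt hX; split => //; apply: leq_trans le_km.
Qed.

Lemma solvable_within_guess X k b :
  (forall c : coloring n, c \in X -> nonminority_ball c [set: 'I_n] b) ->
  solvable_within X k.
Proof.
move=> bP; exists (Guess q b) => h b' rt _.
by inversion rt; subst; split => // c cX _; apply: bP.
Qed.

Lemma solvable_within_ask X k Q :
  (forall a, solvable_within [set c in X | majority_ball c (val Q) a] k) ->
  solvable_within X k.+1.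
Proof.
move=> /fin_all_exists[f fP]; exists (Ask Q f) => h b rt.
inversion rt as [|? ? a h' ? rf]; subst => -[c cX] /= /andP[ca ch].
have [|sz ok] := fP a h' b rf; first by exists c => //; rewrite inE cX.
by split=> // d dX /andP[da dh]; apply: ok => //; rewrite inE dX.
Qed.

(** On each branch, the answer to [Q] is a majority ball of [Q] in all remaining colorings. *)
Lemma solvable_within_ask_all X k (s : seq (query q n)) :
  (forall Y, Y \subset X -> (forall Q, Q \in s -> common_majority Y (val Q)) ->
     solvable_within Y k) ->
  solvable_within X (size s + k).
Proof.
elim: s X => [|Q s IHs] X contX; first by apply: contX.
apply: (@solvable_within_ask _ _ Q) => a; apply: IHs => Y sYX goodY.
apply: contX; first by apply: subset_trans sYX _; apply/subsetP => c; rewrite inE => /andP[].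
move=> Q'; rewrite in_cons => /orP[/eqP->|/goodY//].
by exists a => c /(subsetP sYX); rewrite inE => /andP[].
Qed.

End Strategies.

(** * Quadratic adaptive upper bound *)

Section AdaptiveUpperBound.
Variables l n : nat.
Hypothesis l_gt0 : 0 < l.
Local Notation q := (2 * l + 1).
Implicit Types (X Y : {set {ffun 'I_n -> bool}}) (K U D W : {set 'I_n}) (c : coloring n).

(** For [#|K| = 2 * l], such a [v] is the strict majority color of [K]; the condition is vacuous
    when [K] is split evenly. *)
Definition sifted c K D := forall v, l < #|color_class c K v| -> forall x, x \in D -> c x = v.

(** If [v] has more than [l] balls in the new set, it is the majority color of [z |: K], hence the
    color of [w]. So [z |: K] has at least [l + 2] balls of color [v] and [K] at least [l + 1],
    which settles the balls of [D]. *)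
Lemma sifted_step c K D z w : #|K| = 2 * l -> z \notin K -> majority_ball c (z |: K) w ->
  sifted c K D -> sifted c ((z |: K) :\ w) (w |: D).
Proof.
move=> cK zK; have cQ : #|z |: K| = q by rewrite cardsU1 zK cK addnC.
have oQ : odd #|z |: K| by rewrite cQ; clear; lia.
rewrite majority_ballE // => /andP[wQ /eqP cw] sKD v ltv.
have cv : c w = v.
  apply/eqP; rewrite cw eq_sym -majority_colorP // (color_classD1 _ _ wQ) cQ.
  by move: ltv; clear; case: (_ == _); card_lia.
move=> x; rewrite in_setU1 => /orP[/eqP->//|]; apply: sKD.
have := color_classD1 c v wQ; rewrite (@color_classD1 _ _ _ z) ?setU11 // setU1K // cv eqxx.
by move: ltv; clear; case: (_ == _) => /=; card_lia.
Qed.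

(** The color of [b] has at least [l] balls in [K]: otherwise the other color has a strict majority
    there, and [b], a discarded ball, would have it. *)
Lemma sifted_nonminority c K W b : #|K| = 2 * l -> K \subset W -> sifted c K (W :\: K) ->
  nonminority_ball c (W :\: K) b -> nonminority_ball c W b.
Proof.
move=> cK sKW sK; rewrite /nonminority_ball !same_colorE => /andP[bD nb].
move: (bD); rewrite inE => /andP[_ bW]; rewrite bW /=.
rewrite (color_classD _ _ sKW).
have cW : #|W| = 2 * l + #|W :\: K| by rewrite -(cardsID K) (setIidPr sKW) cK.
have split_K := color_classN c K (c b); rewrite cK in split_K.
have [le_b|lt_nb] := leqP l #|color_class c K (c b)|; first card_lia.
have lt_other : l < #|color_class c K (~~ c b)| by card_lia.
by have := sK _ lt_other b bD; case: (c b).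
Qed.

(** [U] holds the balls still to be added, [W :\: K :\: U] the discarded ones. *)
Lemma solvable_within_sift W k X K U : #|K| = 2 * l -> K \subset W -> U \subset W :\: K ->
  (forall c, c \in X -> sifted c K (W :\: K :\: U)) ->
  (forall Y K', Y \subset X -> #|K'| = 2 * l -> K' \subset W ->
     (forall c, c \in Y -> sifted c K' (W :\: K')) -> solvable_within q Y k) ->
  solvable_within q X (#|U| + k).
Proof.
have [u cU] : exists u, #|U| = u by exists #|U|.
elim: u U cU X K => [|u IHu] U cU X K cK sKW sUW sX cont.
  by rewrite cU; apply: (cont X K) => // c /sX; rewrite (cards0_eq cU) setD0.
have [z zU] : exists z, z \in U by apply/set0Pn; rewrite -card_gt0 cU.
have := subsetP sUW z zU; rewrite inE => /andP[zK zW].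
have cQ : #|z |: K| == q by rewrite cardsU1 zK cK addnC.
rewrite cU addSn; apply: (@solvable_within_ask _ _ _ _ (Sub (z |: K) cQ)) => w /=.
have [wQ|wQ] := boolP (w \in z |: K); last first.
  (* An answer outside the query is consistent with no coloring. *)
  by apply: (@solvable_within_guess _ _ _ _ w) => c; rewrite inE /majority_ball (negPf wQ) andbF.
have sQW : z |: K \subset W by rewrite subUset sub1set zW.
have cU' : #|U :\ z| = u by move: (cardsD1 z U); rewrite zU cU; clear; card_lia.
rewrite -cU'; apply: (IHu (U :\ z) cU' _ ((z |: K) :\ w)).
- by move: (cardsD1 w (z |: K)); rewrite wQ (eqP cQ); clear; card_lia.
- exact: subset_trans (subsetDl _ _) sQW.
- apply/subsetP => y; rewrite !inE => /andP[yz yU].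
  have := subsetP sUW y yU; rewrite !inE => /andP[yK ->].
  by rewrite (negPf yz) (negPf yK) andbF.
- move=> c; rewrite inE => /andP[/sX cX maj_w] v ltv x xD.
  have /(_ v ltv x) := sifted_step cK zK maj_w cX; apply.
  move: xD; rewrite !inE; case: (x == w) => //=.
  case: (eqVneq x z) => [->|]; first by rewrite zU andbF.
  by [].
- move=> Y K' sYX; apply: cont; apply: subset_trans sYX _.
  by apply/subsetP => c; rewrite inE => /andP[].
Qed.

Lemma solvable_within_set W X : 2 * l + 1 <= #|W| ->
  (forall c b, c \in X -> nonminority_ball c W b -> nonminority_ball c [set: 'I_n] b) ->
  solvable_within q X (#|W| ^ 2 + 2 ^ (4 * l)).
Proof.
have [w] := ubnP #|W|; elim: w W X => // w IHw W X ltw geW okX.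
(* Up to [4 * l] balls, all queries inside [W] are affordable; above, removing [2 * l] balls leaves
   at least [2 * l + 1], enough for a query. *)
have [leW|gtW] := leqP #|W| (4 * l).
  pose s := enum [set Q : query q n | val Q \subset W].
  apply: (@solvable_within_le _ _ _ (size s + 0)).
    rewrite addn0; apply: leq_trans (leq_addl _ _).
    apply: (@leq_trans (2 ^ #|W|)); last by rewrite leq_exp2l.
    rewrite -card_powerset -cardE -(card_imset _ val_inj); apply: subset_leq_card.
    by apply/subsetP => A /imsetP[Q]; rewrite !inE => sQW ->.
  apply: solvable_within_ask_all => Y sYX goodY.
  have [|b bP] := common_nonminority (X := Y) l_gt0 geW.
    move=> A sAW /eqP cA; apply: (goodY (Sub A cA)).
    by rewrite mem_enum inE.
  apply: (@solvable_within_guess _ _ _ _ b) => c cY.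
  by apply: okX; [apply: (subsetP sYX)|apply: bP].
have [K sKW cK] : exists2 K : {set 'I_n}, K \subset W & #|K| = 2 * l.
  by apply: exists_subset_card; move: gtW; clear; card_lia.
have cWK K' : K' \subset W -> #|K'| = 2 * l -> #|W| = 2 * l + #|W :\: K'|.
  by move=> sK' cK'; rewrite -(cardsID K') (setIidPr sK') cK'.
pose m := #|W| - 2 * l.
apply: (@solvable_within_le _ _ _ (#|W :\: K| + (m ^ 2 + 2 ^ (4 * l)))).
  rewrite /m addnA leq_add2r; have := cWK K sKW cK; move: (#|W|) (#|W :\: K|) l_gt0.
  by clear; move=> a b; nia.
apply: (@solvable_within_sift W _ X K) => //.
  by move=> c _ v _ x; rewrite setDv inE.
move=> Y K' sYX cK' sK'W siftY.
have cm : #|W :\: K'| = m by have := cWK K' sK'W cK'; rewrite /m; clear; card_lia.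
rewrite -cm; apply: IHw.
- by have := cWK K' sK'W cK'; move: ltw l_gt0; clear; card_lia.
- by have := cWK K' sK'W cK'; move: gtW; clear; card_lia.
- move=> c b cY nb; apply: okX; first exact: (subsetP sYX).
  exact: sifted_nonminority (siftY _ cY) nb.
Qed.

Lemma adaptively_solvable_quadratic : 2 * l + 1 <= n ->
  adaptively_solvable q n (n ^ 2 + 2 ^ (4 * l)).
Proof.
move=> len; have [||t tP] := @solvable_within_set [set: 'I_n] [set: {ffun 'I_n -> bool}].
- by rewrite cardsT card_ord.
- by [].
exists t => h b rt [c hc]; have [|sz ok] := tP h b rt; first by exists c; rewrite ?inE.
split; first by move: sz; rewrite cardsT card_ord.
by move=> d; apply: ok; rewrite inE.
Qed.

End AdaptiveUpperBound.

(** * Solvability by asking all queries at once *)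

Lemma nonadaptively_solvable_all l n : 0 < l -> 2 * l + 1 <= n ->
  nonadaptively_solvable (2 * l + 1) n #|{: query (2 * l + 1) n}|.
Proof.
move=> l_gt0 len.
have sz : size (enum {: query (2 * l + 1) n}) == #|{: query (2 * l + 1) n}| by rewrite cardE.
pose Qs := Tuple sz; exists Qs.
suff /fin_all_exists[g gP] : forall answers : #|{: query (2 * l + 1) n}|.-tuple 'I_n,
    exists b, guaranteed_nonminority (zip Qs answers) b by exists g.
move=> answers; pose X := [set c : {ffun 'I_n -> bool} | consistent (zip Qs answers) c].
have [||b bP] := @common_nonminority n X l [set: 'I_n] l_gt0; last first.
- by exists b => c hc; apply: bP; rewrite inE.
- move=> A _ /eqP cA; pose Q : query (2 * l + 1) n := Sub A cA.
  have QQs : Q \in Qs by rewrite mem_enum.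
  have lt_i : index Q Qs < size (zip Qs answers).
    by rewrite size_zip !size_tuple minnn; rewrite -index_mem size_tuple in QQs.
  have n_gt0 : 0 < n by move: len; clear; lia.
  exists (nth (Ordinal n_gt0) answers (index Q Qs)) => c; rewrite inE /consistent.
  move=> /(all_nthP (Q, Ordinal n_gt0))/(_ _ lt_i).
  by rewrite nth_zip ?size_tuple // nth_index.
- by rewrite cardsT card_ord.
Qed.

(** * Cubic nonadaptive lower bound *)

Section Adversary.
Variables l n : nat.
Implicit Types (A B C D R Y E Q : {set 'I_n}).

Definition indicator E : coloring n := [ffun x => x \in E].

Lemma color_class_indicator E Q : color_class (indicator E) Q true = Q :&: E.
Proof. by apply/setP => x; rewrite !inE ffunE eqb_id. Qed.

Lemma indicator_majority E Q a : a \in Q ->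
  (if a \in E then #|Q| < 2 * #|Q :&: E| else 2 * #|Q :&: E| < #|Q|) ->
  majority_ball (indicator E) Q a.
Proof.
move=> aQ; rewrite /majority_ball aQ same_colorE [indicator E a]ffunE.
have := card_color_class (indicator E) Q; rewrite color_class_indicator.
by case: (a \in E); rewrite ?color_class_indicator; card_lia.
Qed.

Lemma indicator_minority E a : a \in E -> 2 * #|E| < n ->
  ~~ nonminority_ball (indicator E) [set: 'I_n] a.
Proof.
move=> aE ltE; rewrite /nonminority_ball inE same_colorE [indicator E a]ffunE aE.
by rewrite color_class_indicator setTI cardsT card_ord -ltnNge.
Qed.

(* Write the type of a ball as its vector of colors in the three colorings:
   [A], [B], [R], [Y] have types 100, 011, 010, 001.  The only majority vector that is
   not the type of a ball of [Q] is 000; it needs balls of [R] and of [Y] in [Q],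
   and then also a ball of [A]. *)
Lemma indicators_common_answer A B R Y Q : #|Q| = 2 * l + 1 ->
  [disjoint B & R] -> [disjoint B & Y] -> [disjoint R & Y] -> A = ~: (B :|: R :|: Y) ->
  (Q :&: R != set0 -> Q :&: Y != set0 -> Q :&: A = set0) ->
  exists a, [/\ majority_ball (indicator A) Q a,
    majority_ball (indicator (B :|: R)) Q a & majority_ball (indicator (B :|: Y)) Q a].
Proof.
move=> cQ dBR dBY dRY defA noA.
have QU C D : [disjoint C & D] -> #|Q :&: (C :|: D)| = #|Q :&: C| + #|Q :&: D|.
  by move=> dCD; rewrite setIUr cardsU setIACA setIid (disjoint_setI0 dCD) setI0 cards0 subn0.
have cQ4 : #|Q :&: A| + #|Q :&: B| + #|Q :&: R| + #|Q :&: Y| = 2 * l + 1.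
  have dBRY : [disjoint B :|: R & Y] by rewrite -setI_eq0 setIUl !disjoint_setI0 // setU0.
  rewrite -cQ -(cardsID (B :|: R :|: Y) Q) !QU // setDE -defA.
  by clear; card_lia.
have cBR := QU _ _ dBR; have cBY := QU _ _ dBY.
have pick_in C : 0 < #|Q :&: C| -> exists2 a, a \in Q & a \in C.
  by rewrite card_gt0 => /set0Pn[a]; rewrite inE => /andP[]; exists a.
have notA a : a \in B :|: R :|: Y -> a \notin A by rewrite defA !inE => ->.
have [ltA|leA] := ltnP l #|Q :&: A|.
  have [|a aQ aA] := pick_in A; first by move: ltA; clear; card_lia.
  have aBRY : a \notin B :|: R :|: Y by rewrite -in_setC -defA.
  rewrite !inE !negb_or -andbA in aBRY; case/and3P: aBRY => /negPf aB /negPf aR /negPf aY.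
  exists a; split; apply: indicator_majority; rewrite // ?inE ?aA ?aB ?aR ?aY /= ?cBR ?cBY cQ;
    by move: ltA cQ4; clear; card_lia.
have [ltBR|leBR] := ltnP l #|Q :&: (B :|: R)|; have [ltBY|leBY] := ltnP l #|Q :&: (B :|: Y)|.
- have [|a aQ aB] := pick_in B.
    by move: ltBR ltBY cQ4; rewrite cBR cBY; clear; card_lia.
  have /negPf aA : a \notin A by apply: notA; rewrite !inE aB.
  exists a; split; apply: indicator_majority; rewrite // ?inE ?aA ?aB /= cQ;
    by move: leA ltBR ltBY; clear; card_lia.
- have [|a aQ aR] := pick_in R.
    by move: ltBR leBY cQ4; rewrite cBR cBY; clear; card_lia.
  have /negPf aA : a \notin A by apply: notA; rewrite !inE aR orbT.
  have aB := disjointFl dBR aR; have aY := disjointFr dRY aR.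
  exists a; split; apply: indicator_majority; rewrite // ?inE ?aA ?aB ?aR ?aY /= cQ;
    by move: leA ltBR leBY; clear; card_lia.
- have [|a aQ aY] := pick_in Y.
    by move: leBR ltBY cQ4; rewrite cBR cBY; clear; card_lia.
  have /negPf aA : a \notin A by apply: notA; rewrite !inE aY orbT.
  have aB := disjointFl dBY aY; have aR := disjointFl dRY aY.
  exists a; split; apply: indicator_majority; rewrite // ?inE ?aA ?aB ?aR ?aY /= cQ;
    by move: leA leBR ltBY; clear; card_lia.
have R0 : Q :&: R != set0.
  by rewrite -card_gt0; move: leA leBY cQ4; rewrite cBY; clear; card_lia.
have Y0 : Q :&: Y != set0.
  by rewrite -card_gt0; move: leA leBR cQ4; rewrite cBR; clear; card_lia.
move: leBR leBY cQ4; rewrite cBR cBY (noA R0 Y0) cards0; clear.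
by move=> *; exfalso; card_lia.
Qed.

Variables (k : nat) (Qs : k.-tuple (query (2 * l + 1) n)) (guess : k.-tuple 'I_n -> 'I_n).
Hypothesis guessP : forall answers : k.-tuple 'I_n,
  guaranteed_nonminority (zip Qs answers) (guess answers).

Definition meets (t : 'I_k) R := val (tnth Qs t) :&: R != set0.

(** With fewer queries, their balls outside [R :|: Y] fit into a small [B]. Then [A], [B :|: R] and
    [B :|: Y] cover all balls, each is a minority class, and common answers fit all three colorings,
    so every guess fails. *)
Lemma many_queries_meet_both R Y : 4 < n -> #|R| = 2 -> #|Y| = 2 -> [disjoint R & Y] ->
  n - 4 - n.-1./2 < #|[set t | meets t R && meets t Y]| * (2 * l + 1).
Proof.
move=> n_gt4 cR cY dRY; rewrite ltnNge; apply/negP => few.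
pose T := (\bigcup_(t | meets t R && meets t Y) val (tnth Qs t)) :\: (R :|: Y).
have cRY : #|R :|: Y| = 4.
  by rewrite cardsU cR cY (disjoint_setI0 dRY) cards0.
have cV : #|~: (R :|: Y)| = n - 4 by rewrite cardsCs setCK card_ord cRY.
(* This is the least size of [B] for which [A] has fewer than [n / 2] balls; [B :|: R] and [B :|: Y]
   stay below [n / 2] too. *)
have [||B [sTB sBV cB]] := @exists_between_card _ T (~: (R :|: Y)) (n - 4 - n.-1./2).
- by rewrite /T setDE subsetIr.
- rewrite cV leq_subr andbT; apply: leq_trans few.
  apply: leq_trans (subset_leq_card (subsetDl _ _)) _.
  by apply: card_bigcup_leq => t _; rewrite (eqP (valP (tnth Qs t))).
have dB C : C \subset R :|: Y -> [disjoint B & C].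
  by move=> sC; rewrite disjoints_subset (subset_trans sBV) // setCS.
have dBR := dB _ (subsetUl R Y); have dBY := dB _ (subsetUr R Y).
pose A := ~: (B :|: R :|: Y).
have cBR : #|B :|: R| = n - 4 - n.-1./2 + 2.
  by rewrite cardsU (disjoint_setI0 dBR) cards0 subn0 cB cR.
have cBY : #|B :|: Y| = n - 4 - n.-1./2 + 2.
  by rewrite cardsU (disjoint_setI0 dBY) cards0 subn0 cB cY.
have cA : #|A| = n - (n - 4 - n.-1./2 + 4).
  by rewrite cardsCs setCK card_ord -setUA cardsU (disjoint_setI0 (dB _ (subxx _)))
    cards0 subn0 cB cRY.
have /fin_all_exists[f fP] : forall t : 'I_k, exists a,
    [/\ majority_ball (indicator A) (val (tnth Qs t)) a,
        majority_ball (indicator (B :|: R)) (val (tnth Qs t)) a &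
        majority_ball (indicator (B :|: Y)) (val (tnth Qs t)) a].
  move=> t; apply: indicators_common_answer => //; first exact: eqP (valP (tnth Qs t)).
  move=> tR tY; apply/setP => x; rewrite !inE; apply/andP => -[xQ].
  rewrite -orbA negb_or => /andP[/negP xB xRY]; apply: xB; apply: (subsetP sTB).
  rewrite !inE xRY; apply/bigcupP; exists t => //; rewrite /meets tR; exact: tY.
pose answers := [tuple f t | t < k].
have consE E : (forall t, majority_ball (indicator E) (val (tnth Qs t)) (f t)) ->
    consistent (zip Qs answers) (indicator E).
  move=> fE; apply/all_tnthP => t.
  have zipE : nth (tnth Qs t, f t) (zip Qs answers) t = (tnth Qs t, f t).
    by rewrite nth_zip ?size_tuple // -!tnth_nth tnth_mktuple.
  rewrite (tnth_nth (tnth Qs t, f t)) zipE; exact: fE.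
have minE E : (forall t, majority_ball (indicator E) (val (tnth Qs t)) (f t)) ->
    2 * #|E| < n -> guess answers \notin E.
  move=> /consE/guessP nb ltE; apply/negP => gE.
  by have := indicator_minority gE ltE; rewrite nb.
have /negP[] : guess answers \notin A.
  by apply: minE => [t|]; [case: (fP t)|rewrite cA; move: n_gt4; clear; lia].
have gBR : guess answers \notin B :|: R.
  by apply: minE => [t|]; [case: (fP t)|rewrite cBR; move: n_gt4; clear; lia].
have gBY : guess answers \notin B :|: Y.
  by apply: minE => [t|]; [case: (fP t)|rewrite cBY; move: n_gt4; clear; lia].
by move: gBR gBY; rewrite !inE !negb_or => /andP[-> ->] /andP[_ ->].
Qed.

(** The pairs are disjoint, so a query meets at most as many of them as it has balls; for odd [n]
    the last ball lies in no pair. *)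
Definition ball_pair (i : 'I_n./2) : {set 'I_n} := [set x : 'I_n | x./2 == i].

Lemma card_ball_pair i : #|ball_pair i| = 2.
Proof.
have lt0 : i.*2 < n by case: i => i /=; clear; lia.
have lt1 : i.*2.+1 < n by case: i lt0 => i /=; clear; lia.
have -> : ball_pair i = [set Ordinal lt0; Ordinal lt1].
  apply/setP => x; rewrite !inE -!val_eqE /=.
  by move: (nat_of_ord x) (nat_of_ord i); clear; lia.
by rewrite cards2 -val_eqE /=; case: eqP => //; lia.
Qed.

Lemma disjoint_ball_pair i j : i != j -> [disjoint ball_pair i & ball_pair j].
Proof.
move=> /eqP ij; rewrite -setI_eq0; apply/eqP/setP => x; rewrite !inE.
by apply/andP => -[/eqP xi /eqP xj]; apply/ij/val_inj; rewrite /= -xi.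
Qed.

Lemma sum_meets_leq t : \sum_i (meets t (ball_pair i) : nat) <= 2 * l + 1.
Proof.
rewrite -[leqRHS](eqP (valP (tnth Qs t))) -sum1_card.
apply: (@leq_trans (\sum_(i < n./2) \sum_(x in val (tnth Qs t)) (x./2 == i :> nat))).
  apply: leq_sum => i _; rewrite /meets; case: set0Pn => //= -[x].
  rewrite !inE => /andP[xQ xi]; rewrite (bigD1 x) //= xi; exact: leq_addr.
rewrite exchange_big; apply: leq_sum => x _ /=.
have [ltx|gex] := ltnP x./2 n./2.
  rewrite (bigD1 (Ordinal ltx)) //= eqxx big1 // => i; rewrite -val_eqE /= eq_sym.
  by case: eqP.
by rewrite big1 // => i _; case: eqP => // E; move: (ltn_ord i); rewrite -E ltnNge gex.
Qed.

(** Double counting of a query with an ordered choice of two distinct pairs it meets: each query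
    occurs at most [(2 * l + 1) ^ 2] times. The third factor is the query size in
    [many_queries_meet_both]. *)
Lemma nonadaptive_count : 4 < n ->
  n./2 * n./2.-1 * (n - 4 - n.-1./2).+1 <= k * (2 * l + 1) ^ 3.
Proof.
move=> n_gt4; pose D i j := #|[set t | meets t (ball_pair i) && meets t (ball_pair j)]|.
apply: (@leq_trans (\sum_(i < n./2) \sum_(j < n./2 | j != i) D i j * (2 * l + 1))).
  rewrite -mulnA -{1}(card_ord n./2) -sum_nat_const; apply: leq_sum => i _.
  have <- : #|[pred j : 'I_n./2 | j != i]| = n./2.-1.
    by have := cardC1 i; rewrite card_ord.
  rewrite -sum_nat_const; apply: leq_sum => j; rewrite inE => ji.
  apply: many_queries_meet_both; rewrite ?card_ball_pair //.
  by apply: disjoint_ball_pair; rewrite eq_sym in ji.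
apply: (@leq_trans (\sum_(i < n./2) \sum_(j < n./2) D i j * (2 * l + 1))).
  by apply: leq_sum => i _; rewrite big_mkcond; apply: leq_sum => j _; case: ifP.
under eq_bigr => i _ do rewrite -big_distrl.
rewrite -big_distrl expnSr mulnA leq_mul2r; apply/orP; right.
have DE i j : D i j = \sum_t (meets t (ball_pair i) * meets t (ball_pair j)).
  by rewrite /D cardsE -sum1_card big_mkcond; apply: eq_bigr => t _;
    rewrite mulnb unfold_in; case: (_ && _).
under eq_bigr => i _ do under eq_bigr => j _ do rewrite DE.
under eq_bigr => i _ do rewrite exchange_big.
rewrite exchange_big /= -[k in k * _]card_ord -sum_nat_const; apply: leq_sum => t _.
under eq_bigr => i _ do rewrite -big_distrr.
by rewrite -big_distrl /= leq_mul // sum_meets_leq.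
Qed.

End Adversary.

Lemma nonadaptive_cubic l n k : 0 < l -> 2 * l + 1 <= n ->
  nonadaptively_solvable (2 * l + 1) n k -> n ^ 3 <= 256 * (2 * l + 1) ^ 3 * k.
Proof.
move=> l_gt0 len [Qs [guess guessP]].
(* For [n < 16] it suffices that [k > 0], as [16 ^ 3 <= 256 * 3 ^ 3]. From 16 on, each factor on the
   left of [nonadaptive_count] is at least [n / 4], which needs only the constant 64. *)
have [lt_n|ge_n] := ltnP n 16.
  case: k Qs guess guessP => [|k] Qs guess guessP.
    have gP := guessP [tuple]; set b := guess [tuple] in gP.
    have /negP[] : ~~ nonminority_ball (indicator [set b]) [set: 'I_n] b.
      by apply: indicator_minority; rewrite ?set11 ?cards1; lia.
    by apply: gP; rewrite tuple0.
  have : n ^ 3 <= 16 ^ 3 by rewrite leq_exp2r // ltnW.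
  have : 3 ^ 3 <= (2 * l + 1) ^ 3 by rewrite leq_exp2r //; lia.
  by move: (n ^ 3) ((2 * l + 1) ^ 3) => a b; clear; nia.
have := nonadaptive_count guessP (leq_trans _ ge_n) => /(_ isT).
have e3 m : m ^ 3 = m * m * m by rewrite !expnS expn0 muln1 mulnA.
have : n * n * n <= (4 * n./2) * (4 * n./2.-1) * (4 * (n - 4 - n.-1./2).+1).
  by rewrite !leq_mul //; lia.
rewrite (e3 n); move: (n * n * n) (_ ^ 3) => a b.
move: (n./2) (n./2.-1) (_ - n.-1./2).+1 => x y z; clear => h1 h2.
have e64 : 4 * x * (4 * y) * (4 * z) = 64 * (x * y * z) by lia.
have := leq_mul (leqnn 64) h2; rewrite -e64 => h3; apply: leq_trans h1 (leq_trans h3 _).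
by rewrite [k * b]mulnC mulnA leq_mul2r leq_mul2r orbT orbT.
Qed.

(** * Existence of the minima and the final bounds *)

Lemma exists_minimum (P : nat -> Prop) k : P k -> exists m, is_minimum P m.
Proof.
move=> Pk; have exP : exists j, `[< P j >] by exists k; apply/asboolP.
case: (ex_minnP exP) => m /asboolP Pm minm; exists m; split=> // j Pj.
by apply: minm; apply/asboolP.
Qed.

Local Open Scope ring_scope.

Theorem theorem5 (R : realType) (l : nat) (hl : (1 <= l)%N) :
  (exists2 c : R, 0 < c &
     forall n : nat, (2 * l + 1 <= n)%N ->
       exists2 m : nat, N_is (2 * l + 1) n m & c * n%:R ^+ 3 <= m%:R) /\
  (exists2 C : R, 0 < C &
     forall n : nat, (2 * l + 1 <= n)%N ->
       exists2 m : nat, A_is (2 * l + 1) n m & m%:R <= C * n%:R ^+ 2).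
Proof.
split.
  have K_gt0 : 0 < (256 * (2 * l + 1) ^ 3)%:R :> R.
    by rewrite ltr0n muln_gt0 /= expn_gt0 addn1.
  exists (256 * (2 * l + 1) ^ 3)%:R^-1; first by rewrite invr_gt0.
  move=> n len.
  have [m mP] := exists_minimum (nonadaptively_solvable_all hl len).
  exists m => //; rewrite mulrC ler_pdivrMr // -natrX -natrM ler_nat mulnC.
  by apply: nonadaptive_cubic => //; case: mP.
(* The additive [2 ^ (4 * l)] is absorbed because [n ^ 2 >= 1]. *)
exists (1 + 2 ^ (4 * l))%:R; first by rewrite ltr0n.
move=> n len; have As := adaptively_solvable_quadratic hl len.
have [m mP] := exists_minimum As.
exists m => //; rewrite -natrX -natrM ler_nat.
apply: leq_trans (mP.2 _ As) _; rewrite mulnDl mul1n leq_add2l leq_pmulr //.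
by rewrite expn_gt0; apply/orP; left; lia.
Qed.
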